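(* Let $V=V_0+V_1$ satisfy the assumptions in the context, and let $\mathcal{K}_1,\ldots,\mathcal{K}_N$ be the tensors defined in the context. Then for $i=1,\ldots,N$, the tensor $\mathcal{K}_i$ satisfies $$e\cdot\mathcal{K}_i(x_0,\ldots,x_i)e=\inf_{v_{i+1},\ldots,v_N\in H^1(\mathbb{T}^d)}\int_{(\mathbb{T}^d)^{N-i}}\left|e+\nabla v_{i+1}(x_{i+1})+\cdots+\nabla v_N(x_N)\right|^2e^{-V(x_0,\ldots,x_N)/\sigma}\,dx_N\cdots dx_{i+1},$$ for all $e\in\mathbb{R}^d$ (and all $(x_0,\ldots,x_i)\in\mathbb{R}^d\times(\mathbb{T}^d)^i$).
   Context: Fix integers $d,N\ge1$ and $\sigma>0$. $\mathbb{T}^d=\mathbb{R}^d/\mathbb{Z}^d$ is the unit torus (volume $1$). Assumptions: $V:\mathbb{R}^d\times(\mathbb{T}^d)^N\to\mathbb{R}$ is smooth and $V(x_0,x_1,\ldots,x_N)=V_0(x_0)+V_1(x_0,x_1,\ldots,x_N)$, where $V_0$ is smooth, $e^{-V_0}\in L^1(\mathbb{R}^d)$, $V_0(x)\to\infty$ as $|x|\to\infty$, $\nabla^2V_0\in L^\infty(\mathbb{R}^d)$, and $V_1$ is smooth and uniformly bounded. Notation: for a vector field $\theta$, $(\nabla_x\theta^\top)_{ij}=\partial_{x_i}\theta_j$. Set $\mathcal{K}_N(x_0,\ldots,x_N)=e^{-V(x_0,\ldots,x_N)/\sigma}I$, with $I$ the $d\times d$ identity. Recursively for $k=N,\ldots,1$: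 $\theta_k=\theta_k(x_0,\ldots,x_k)\in\mathbb{R}^d$, with $\theta_k(x_0,\ldots,x_{k-1},\cdot)\in H^1(\mathbb{T}^d)$, is the weak solution (unique up to an additive constant for fixed $x_0,\ldots,x_{k-1}$) on $\mathbb{T}^d$ of: for every $e\in\mathbb{R}^d$, $\nabla_{x_k}\cdot\big(\mathcal{K}_k(\nabla_{x_k}(\theta_k\cdot e)+e)\big)=0$. For $1\le k\le N-1$, $$\mathcal{K}_k(x_0,\ldots,x_k)=\int_{(\mathbb{T}^d)^{N-k}}(I+\nabla_{x_N}\theta_N^\top)\cdots(I+\nabla_{x_{k+1}}\theta_{k+1}^\top)e^{-V/\sigma}\,dx_N\cdots dx_{k+1}.$$ For $i=N$ there are no functions $v_j$ and no integration.
   Formalization: Each v_j may depend, jointly measurably, on x_{i+1},…,x_{j-1} as parameters besides being in H^1(T^d) in x_j; with v_j a function of x_j alone the formula fails in general when N−i≥2 (e.g. d=1, N=3, i=1), and for N−i≤1 the two readings agree. *)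

(* Defs.v *)
From HB Require Import structures.
From mathcomp Require Import all_boot all_order all_algebra.
From mathcomp Require Import all_classical all_reals all_analysis.

Set Implicit Arguments.
Unset Strict Implicit.
Unset Printing Implicit Defensive.

Import Order.TTheory GRing.Theory Num.Theory.
Import numFieldTopology.Exports numFieldNormedType.Exports.

Local Open Scope classical_set_scope.
Local Open Scope ring_scope.

(* Image of a sigma-finite measure under an injective measurable map with a
   measurable left inverse. The proofs are arguments so that the structure of
   sigma-finite measure can be inferred. *)
Section transport.
Context d1 d2 (T1 : measurableType d1) (T2 : measurableType d2) (R : realType).
Variables (mu : {sigma_finite_measure set T1 -> \bar R}).
Variables (f : T1 -> T2) (g : T2 -> T1).

Definition transport (mf : measurable_fun setT f) (mg : measurable_fun setT g)
  (fK : cancel f g) : set T2 -> \bar R := pushforward mu f.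

Hypotheses (mf : measurable_fun setT f) (mg : measurable_fun setT g).
Hypothesis fK : cancel f g.

Let transport_measure0 : transport mf mg fK set0 = 0%E.
Proof. by rewrite /transport /pushforward preimage_set0 measure0. Qed.

Let transport_ge0 A : (0 <= transport mf mg fK A)%E.
Proof. exact: measure_ge0. Qed.

Let transport_sigma_additive : semi_sigma_additive (transport mf mg fK).
Proof.
move=> F mF tF mUF; rewrite /transport /pushforward preimage_bigcup.
have mfF X : measurable X -> measurable (f @^-1` X).
  by move=> mX; rewrite -[X in measurable X]setTI; exact: mf.
apply: measure_semi_sigma_additive.
- by move=> n; exact: mfF.
- apply/trivIsetP => /= i j _ _ ij; rewrite -preimage_setI.
  by move/trivIsetP : tF => /(_ _ _ _ _ ij) ->//; rewrite preimage_set0.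
- by rewrite -preimage_bigcup; exact: mfF.
Qed.

HB.instance Definition _ := isMeasure.Build _ _ _ (transport mf mg fK)
  transport_measure0 transport_ge0 transport_sigma_additive.

Let transport_sigma_finite : sigma_finite setT (transport mf mg fK).
Proof.
have [F TF Foo] := sigma_finiteT mu.
exists (fun n => g @^-1` F n); first by rewrite -preimage_bigcup -TF preimage_setT.
move=> n; have [mF Fn] := Foo n; split.
  by rewrite -[X in measurable X]setTI; exact: mg.
rewrite /transport /pushforward -comp_preimage (_ : g \o f = id) //.
by apply/funext => x /=; rewrite fK.
Qed.

HB.instance Definition _ := Measure_isSigmaFinite.Build _ _ _
  (transport mf mg fK) transport_sigma_finite.
End transport.

(* m1 \x m2 with its structure of sigma-finite measure: the library's instance
   is shadowed by the one for subprobabilities. *)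
Section sigma_finite_product.
Local Open Scope ereal_scope.
Context d1 d2 (T1 : measurableType d1) (T2 : measurableType d2) (R : realType).
Variable m1 : {sigma_finite_measure set T1 -> \bar R}.
Variable m2 : {sigma_finite_measure set T2 -> \bar R}.

Definition sfprod : set (T1 * T2) -> \bar R := m1 \x m2.

HB.instance Definition _ := Measure.on sfprod.

Let sfprod_sigma_finite : sigma_finite setT sfprod.
Proof.
have /sigma_finiteP[F [TF ndF Foo]] := sigma_finiteT m1.
have /sigma_finiteP[G [TG ndG Goo]] := sigma_finiteT m2.
exists (fun n => F n `*` G n).
  rewrite -setXTT TF TG predeqE => -[x y]; split.
    move=> [/= [n _ Fnx] [k _ Gky]]; exists (maxn n k) => //; split.
    - by move: x Fnx; exact/subsetPset/ndF/leq_maxl.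
    - by move: y Gky; exact/subsetPset/ndG/leq_maxr.
  by move=> [n _ []/= ? ?]; split; exists n.
move=> k; have [? ?] := Foo k; have [? ?] := Goo k.
split; first exact: measurableX.
by rewrite /sfprod product_measure1E// lte_mul_pinfty// ge0_fin_numE.
Qed.

HB.instance Definition _ := Measure_isSigmaFinite.Build _ _ _ sfprod
  sfprod_sigma_finite.
End sigma_finite_product.

(* The n-fold product measure on n.-tuple T. *)
Section tuple_product.
Context d (T : measurableType d) (R : realType).
Variable mu : {sigma_finite_measure set T -> \bar R}.

Definition tcons n (p : T * n.-tuple T) : n.+1.-tuple T :=
  [tuple of p.1 :: p.2].

Definition tuncons n (t : n.+1.-tuple T) : T * n.-tuple T :=
  (thead t, [tuple of behead t]).

Lemma tconsK n : cancel (@tcons n) (@tuncons n).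
Proof. by move=> [x t]; congr pair; exact/val_inj. Qed.

Lemma measurable_tcons n : measurable_fun setT (@tcons n).
Proof. exact: measurable_cons. Qed.

Lemma measurable_tuncons n : measurable_fun setT (@tuncons n).
Proof.
apply/measurable_fun_pairP; split; last exact: measurable_behead.
exact: measurable_tnth.
Qed.

Fixpoint tprod n : {sigma_finite_measure set (n.-tuple T) -> \bar R} :=
  if n is m.+1 then
    transport (sfprod mu (tprod m)) (@measurable_tcons m)
      (@measurable_tuncons m) (@tconsK m)
  else \d_ ([tuple] : 0.-tuple T).
End tuple_product.

(* The product sigma-algebra on matrices (for entries in R, the Borel one). *)
Definition measure_matrix_display : measure_display -> measure_display.
Proof. exact. Qed.

Definition mx_tuple (T : Type) m n (A : 'M[T]_(m, n)) : m.-tuple (n.-tuple T) :=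
  [tuple [tuple A a b | b < n] | a < m].

Definition tuple_mx (T : Type) m n (t : m.-tuple (n.-tuple T)) : 'M[T]_(m, n) :=
  \matrix_(a, b) tnth (tnth t a) b.

Section measurable_matrix.
Context d (T : measurableType d) (m n : nat).

Let G := preimage_set_system setT (@mx_tuple T m n) measurable.

Let sigmaG : sigma_algebra setT G.
Proof. exact/sigma_algebra_preimage/sigma_algebra_measurable. Qed.

Let G0 : G set0. Proof. by case: sigmaG. Qed.

Let GC A : G A -> G (~` A).
Proof. by case: sigmaG => _ + _ => /[apply]; rewrite setTD. Qed.

Let GU (F : (set 'M[T]_(m, n))^nat) :
  (forall i, G (F i)) -> G (\bigcup_i (F i)).
Proof. by case: sigmaG => _ _; exact. Qed.

HB.instance Definition _ := @isMeasurable.Build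
  (measure_matrix_display (measure_tuple_display (measure_tuple_display d)))
 'M[T]_(m, n) G G0 GC GU.
End measurable_matrix.

Section column_measure.
Context d (T : measurableType d) (R : realType) (n : nat).

Definition cv_tuple (A : 'cV[T]_n) : n.-tuple T := [tuple A i ord0 | i < n].

Definition tuple_cv (t : n.-tuple T) : 'cV[T]_n := \col_i tnth t i.

Lemma tuple_cvK : cancel tuple_cv cv_tuple.
Proof. by move=> t; apply: eq_from_tnth => i; rewrite tnth_mktuple mxE. Qed.

Lemma measurable_cv_tuple : measurable_fun setT cv_tuple.
Proof.
apply/measurable_fun_tnthP => i.
rewrite (_ : _ \o _ =
  (fun t => tnth t ord0) \o ((fun t => tnth t i) \o @mx_tuple T n 1)).
  apply: measurableT_comp; first exact: measurable_tnth.
  apply: measurableT_comp; first exact: measurable_tnth.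
  by move=> _ Y mY; exists Y.
by apply/funext => A /=; rewrite !tnth_mktuple.
Qed.

Lemma measurable_tuple_cv : measurable_fun setT tuple_cv.
Proof.
move=> _ _ [Y mY <-]; rewrite !setTI -comp_preimage.
rewrite -[X in measurable X]setTI.
suff : measurable_fun setT (@mx_tuple T n 1 \o tuple_cv) by exact.
apply/measurable_fun_tnthP => i; apply/measurable_fun_tnthP => j.
rewrite (_ : _ \o _ = fun t => tnth t i); first exact: measurable_tnth.
by apply/funext => t /=; rewrite !tnth_mktuple mxE.
Qed.

(* The n-fold product measure, on column vectors. *)
Definition cvprod (mu : {sigma_finite_measure set T -> \bar R}) :=
  transport (tprod mu n) measurable_tuple_cv measurable_cv_tuple tuple_cvK.
End column_measure.
Arguments cvprod {d T R} n mu.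


Section measures.
Variable R : realType.

(* lebesgue_measure lives on measurableTypeR R, which has the same sets and
   sigma-algebra as R but another display. *)
Let to_R : measurableTypeR R -> R := idfun.
Let of_R : R -> measurableTypeR R := idfun.

Let measurable_to_R : measurable_fun setT to_R.
Proof. by move=> _ A mA; rewrite setTI. Qed.

Let measurable_of_R : measurable_fun setT of_R.
Proof. by move=> _ A mA; rewrite setTI. Qed.

Let to_RK : cancel to_R of_R. Proof. by []. Qed.

Definition lebesgue_cv d : {sigma_finite_measure set 'cV[R]_d -> \bar R} :=
  cvprod d (transport (@lebesgue_measure R)
    measurable_to_R measurable_of_R to_RK).

(* The Lebesgue measure of [0, 1]^d, as a measure on R^d: integrating against
   it is integrating over the unit torus. *)
Definition torus_measure d : {sigma_finite_measure set 'cV[R]_d -> \bar R} :=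
  cvprod d (transport (uniform_prob (@ltr01 R))
    measurable_to_R measurable_of_R to_RK).
End measures.

Section smoothness.
Variables (R : realType) (E : normedModType R).

(* k times continuously differentiable (on a finite-dimensional E). *)
Fixpoint Ck (k : nat) (f : E -> R) : Prop :=
  if k is k'.+1 then
    forall u, (forall x, derivable f x u) /\ Ck k' (fun x => 'D_u f x)
  else continuous f.

Definition smooth (f : E -> R) := forall k, Ck k f.
End smoothness.

Definition dot (R : realType) d (u w : 'cV[R]_d) : R := \sum_i u i ord0 * w i ord0.

Notation partial a f x := ('D_(delta_mx a ord0) f x).

(* Functions on the torus T^d are Z^d-periodic functions on R^d, and functions
   on R^d x (T^d)^k are functions of k.+1 points of R^d, periodic in all but the
   first one. *)
Section periodicity.
Variables (R : realType) (d : nat) (S : Type).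

Definition periodic (f : 'cV[R]_d -> S) :=
  forall (x : 'cV[R]_d) (z : 'cV[int]_d), f (x + map_mx intr z) = f x.

(* Periodicity in the variables of index at least m. *)
Definition periodic_from (m n : nat) (F : n.-tuple 'cV[R]_d -> S) :=
  forall (x : n.-tuple 'cV[R]_d) (z : 'I_n -> 'cV[int]_d),
    (forall l : 'I_n, (l < m)%N -> z l = 0) ->
    F [tuple tnth x l + map_mx intr (z l) | l < n] = F x.
End periodicity.

(* [initial n s] is the configuration made of the first n points of s. *)
Definition initial (R : realType) d n (s : seq 'cV[R]_d) : n.-tuple 'cV[R]_d :=
  [tuple nth 0 s l | l < n].

Section sobolev.
Variables (R : realType) (d : nat).
Local Notation point := 'cV[R]_d.
Local Notation T1 := (torus_measure R d).

(* v belongs to H^1(T^d) and g is its weak gradient. *)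
Record is_H1 (v : point -> R) (g : point -> point) : Prop := {
  H1_periodic : periodic v ;
  H1_grad_periodic : periodic g ;
  H1_L2 : v \in Lfun T1 2%:E ;
  H1_grad_L2 : forall a, (fun y => g y a ord0) \in Lfun T1 2%:E ;
  H1_weak : forall phi : point -> R, smooth phi -> periodic phi -> forall a,
    \int[T1]_y (v y * partial a phi y) = - \int[T1]_y (g y a ord0 * phi y) }.
End sobolev.

Section homogenization.
Variables (R : realType) (d N : nat) (sigma : R).
Local Notation point := 'cV[R]_d.
Local Notation torus_power n := (tprod (torus_measure R d) n).

Record potential (V : N.+1.-tuple point -> R) (V0 : point -> R)
    (V1 : N.+1.-tuple point -> R) : Prop := {
  V_split : forall x, V x = V0 (thead x) + V1 x ;
  V_smooth : smooth (fun A : 'M[R]_(d, N.+1) => V [tuple col l A | l < N.+1]) ;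
  V_periodic : periodic_from 1 V ;
  V0_smooth : smooth V0 ;
  V0_integrable : (fun x => expR (- V0 x)) \in Lfun (lebesgue_cv R d) 1 ;
  V0_confining : forall M : R, exists r : R, forall x, r <= `|x| -> M <= V0 x ;
  V0_hessian : forall a b,
    (fun x => partial a (fun y => partial b V0 y) x)
      \in Lfun (lebesgue_cv R d) +oo%E ;
  V1_smooth : smooth (fun A : 'M[R]_(d, N.+1) => V1 [tuple col l A | l < N.+1]) ;
  V1_periodic : periodic_from 1 V1 ;
  V1_bounded : exists C : R, forall x, `|V1 x| <= C }.

Variable V : N.+1.-tuple point -> R.

Section tensors.
(* Dtheta k stands for the matrix of entries (a, b) the weak derivatives
   d theta_{k, b} / d x_{k, a}. *)
Variables (theta : forall k, k.+1.-tuple point -> point).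
Variables (Dtheta : forall k, k.+1.-tuple point -> 'M[R]_d).
Arguments theta : clear implicits.
Arguments Dtheta : clear implicits.

(* K_k, with factors I + Dtheta_N, ..., I + Dtheta_{k+1} from left to right. For
   k = N the product is empty and the integral is over a single point: see
   [tensor_top]. *)
Definition tensor (k : nat) (x : k.+1.-tuple point) : 'M[R]_d :=
  \matrix_(a, b) \int[torus_power (N - k)]_y
    ((\big[mulmx/1%:M]_(l < N - k)
        (1%:M + Dtheta (N - l) (initial (N - l).+1 (x ++ y)))) a b
     * expR (- V (initial N.+1 (x ++ y)) / sigma)).

Lemma tensor_top (x : N.+1.-tuple point) :
  tensor x = expR (- V x / sigma) *: 1%:M.
Proof.
apply/matrixP => a b; rewrite !mxE subnn.
rewrite /Rintegral integral_dirac //=; last first.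
  set f := (f in measurable_fun _ f).
  rewrite (_ : f = cst (f [tuple])); first exact: measurable_cst.
  by apply/funext => y; rewrite (tuple0 y).
rewrite indicT mul1r big_ord0 mxE mulrC; congr (expR (- V _ / sigma) * _).
by apply: eq_from_tnth => l; rewrite tnth_mktuple /= cats0 -tnth_nth.
Qed.

Record cell_solution (k : nat) : Prop := {
  theta_measurable : measurable_fun setT (theta k) ;
  Dtheta_measurable : measurable_fun setT (Dtheta k) ;
  theta_periodic : periodic_from 1 (theta k) ;
  Dtheta_periodic : periodic_from 1 (Dtheta k) ;
  theta_H1 : forall (p : k.-tuple point) b,
    is_H1 (fun y => theta k [tuple of rcons p y] b ord0)
          (fun y => col b (Dtheta k [tuple of rcons p y])) ;
  theta_weak : forall (p : k.-tuple point) (e : point) v g, is_H1 v g ->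
    \int[torus_measure R d]_y
      dot (tensor [tuple of rcons p y] *m
             (Dtheta k [tuple of rcons p y] *m e + e)) (g y) = 0 }.
End tensors.

(* [v l] is the function v_{i+l+1}, and [g l] its gradient in x_{i+l+1}. As for
   the theta_k, v_j belongs to H^1(T^d) as a function of x_j, and may depend on
   the variables x_{i+1}, ..., x_{j-1} that come before as parameters (as it may
   on x_0, ..., x_i, which are fixed). The dependence cannot be dropped when
   n >= 2: for d = 1 and N = i + 2, the minimizer satisfies
   1 + v_{i+1}' + v_{i+2}' = c e^{V/sigma}, which in general is not a function of
   x_{i+1} plus a function of x_{i+2}. *)
Record competitor (n : nat) (v : forall l, l.+1.-tuple point -> R)
    (g : forall l, l.+1.-tuple point -> point) : Prop := {
  v_measurable : forall l, (l < n)%N -> measurable_fun setT (@v l) ;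
  g_measurable : forall l, (l < n)%N -> measurable_fun setT (@g l) ;
  v_periodic : forall l, (l < n)%N -> periodic_from 0 (@v l) ;
  g_periodic : forall l, (l < n)%N -> periodic_from 0 (@g l) ;
  v_H1 : forall l, (l < n)%N -> forall p : l.-tuple point,
    is_H1 (fun y => v l [tuple of rcons p y]) (fun y => g l [tuple of rcons p y]) }.

Definition energy (i : nat) (x : i.+1.-tuple point) (e : point)
    (g : forall l, l.+1.-tuple point -> point) : \bar R :=
  (\int[torus_power (N - i)]_y
    (let w := e + \sum_(l < N - i) g l (initial l.+1 y) in
     dot w w * expR (- V (initial N.+1 (x ++ y)) / sigma))%:E)%E.
End homogenization.

(* Main.v *)
(* Write P for the product (I + D theta_N) ... (I + D theta_{k+1}). By backward
   induction on k, K_k is symmetric, 0 <= K_k <= beta(x_0) I, and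
   u . K_k u = int |P u|^2 e^{-V/sigma}. Indeed, by Fubini,
   K_{k-1} = int K_k (I + D theta_k) dx_k, and testing the cell problem with
   theta_k . u gives u . K_{k-1} v = int (I + D theta_k) u . K_k (I + D theta_k) v.
   For u = v this is the minimum of int (u + grad f) . K_k (u + grad f) over f in
   H^1; comparison with f = 0 propagates the upper bound, hence all integrability.
   The lower bound on the energy of a competitor follows by integrating out the
   last variables first and using this minimality at each level. Equality holds
   for grad v_j = D theta_j (I + D theta_{j-1}) ... (I + D theta_{i+1}) e, whose
   sum with e telescopes to P e. *)
From HB Require Import structures.
From mathcomp Require Import all_boot all_order all_algebra.
From mathcomp Require Import all_classical all_reals all_analysis.
From mathcomp Require Import measurable_realfun lra.
Require Import Defs.

Set Implicit Arguments.
Unset Strict Implicit.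
Unset Printing Implicit Defensive.

Import Order.TTheory GRing.Theory Num.Theory.
Import numFieldTopology.Exports numFieldNormedType.Exports.

Local Open Scope classical_set_scope.
Local Open Scope ring_scope.

(** * Measurability *)

(* So that big_ord_recr applies to matrix products of fixed dimension. *)
HB.instance Definition _ (R : realType) n := Monoid.isLaw.Build 'M[R]_n 1%:M
  (@mulmx R n n n) (@mulmxA R n n n n) (@mul1mx R n n) (@mulmx1 R n n).

Section measurable_matrix_theory.
Context d (T : measurableType d) d' (S : measurableType d').

Lemma measurable_mx_entry m n (i : 'I_m) (j : 'I_n) :
  measurable_fun setT (fun A : 'M[T]_(m, n) => A i j).
Proof.
rewrite (_ : (fun _ => _) =
  (fun t => tnth t j) \o ((fun t => tnth t i) \o @mx_tuple T m n)).
  apply: measurableT_comp; first exact: measurable_tnth.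
  apply: measurableT_comp; first exact: measurable_tnth.
  (* The sigma-algebra on matrices is by definition the preimage of that on tuples of rows under
     [mx_tuple], so [mx_tuple] is measurable. *)
  by move=> _ Y mY; exists Y.
by apply/funext => A /=; rewrite !tnth_mktuple.
Qed.

Lemma measurable_mxP m n (f : S -> 'M[T]_(m, n)) :
  measurable_fun setT f <-> forall i j, measurable_fun setT (fun x => f x i j).
Proof.
split=> [mf i j|mf].
  exact: (measurableT_comp (measurable_mx_entry i j) mf).
(* Every measurable set of matrices is the preimage of some [Y] under [mx_tuple], which leaves the
   measurability of [mx_tuple \o f], a question about entries. *)
move=> _ _ [Y mY <-]; rewrite !setTI -comp_preimage.
rewrite -[X in measurable X]setTI.
suff : measurable_fun setT (@mx_tuple T m n \o f) by exact.
apply/measurable_fun_tnthP => i; apply/measurable_fun_tnthP => j.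
rewrite (_ : _ \o _ = fun x => f x i j) //.
by apply/funext => t /=; rewrite !tnth_mktuple.
Qed.
End measurable_matrix_theory.

Section measurable_matrix_algebra.
Context (R : realType) d' (S : measurableType d').

Lemma measurable_mulmx m n p (f : S -> 'M[R]_(m, n)) (g : S -> 'M[R]_(n, p)) :
  measurable_fun setT f -> measurable_fun setT g ->
  measurable_fun setT (fun x => f x *m g x).
Proof.
move=> /measurable_mxP mf /measurable_mxP mg; apply/measurable_mxP => i j.
under eq_fun do rewrite mxE.
by apply: measurable_sum => k; exact: measurable_funM.
Qed.

Lemma measurable_addmx m n (f g : S -> 'M[R]_(m, n)) :
  measurable_fun setT f -> measurable_fun setT g ->
  measurable_fun setT (fun x => f x + g x).
Proof.
move=> /measurable_mxP mf /measurable_mxP mg; apply/measurable_mxP => i j.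
by under eq_fun do rewrite mxE; exact: measurable_funD.
Qed.

Lemma measurable_oppmx m n (f : S -> 'M[R]_(m, n)) :
  measurable_fun setT f -> measurable_fun setT (fun x => - f x).
Proof.
move=> /measurable_mxP mf; apply/measurable_mxP => i j.
by under eq_fun do rewrite mxE; exact: measurableT_comp.
Qed.

Lemma measurable_summx m n (I : Type) (s : seq I) (f : I -> S -> 'M[R]_(m, n)) :
  (forall i, measurable_fun setT (f i)) ->
  measurable_fun setT (fun x => \sum_(i <- s) f i x).
Proof.
move=> mf; apply/measurable_mxP => i j.
under eq_fun do rewrite summxE.
by apply: measurable_sum => k; move/measurable_mxP: (mf k).
Qed.

Lemma measurable_dot n (f g : S -> 'cV[R]_n) :
  measurable_fun setT f -> measurable_fun setT g ->
  measurable_fun setT (fun x => dot (f x) (g x)).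
Proof.
move=> /measurable_mxP mf /measurable_mxP mg.
by apply: measurable_sum => k; exact: measurable_funM.
Qed.

Lemma measurable_prodmx n m (f : 'I_m -> S -> 'M[R]_n) :
  (forall i, measurable_fun setT (f i)) ->
  measurable_fun setT (fun x => \big[mulmx/1%:M]_(i < m) f i x).
Proof.
elim: m f => [|m IH] f mf.
  by under eq_fun do rewrite big_ord0; exact: measurable_cst.
rewrite (_ : (fun _ => _) = fun x =>
    (\big[mulmx/1%:M]_(i < m) f (widen_ord (leqnSn m) i) x) *m f ord_max x);
  last by apply/funext => x; rewrite big_ord_recr.
by apply: measurable_mulmx => //; apply: IH.
Qed.
End measurable_matrix_algebra.

Section measurable_configurations.
Context (R : realType) (d : nat).
Local Notation point := 'cV[R]_d.

(** Whether entry [l] comes from [f], from [g] or is the default 0 depends on [l] alone and not on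
    [s], because tuples have a fixed length. *)
Lemma measurable_initial_cat n m k d' (S : measurableType d')
    (f : S -> m.-tuple point) (g : S -> k.-tuple point) :
  measurable_fun setT f -> measurable_fun setT g ->
  measurable_fun setT (fun s => initial n (f s ++ g s)).
Proof.
move=> /measurable_fun_tnthP mf /measurable_fun_tnthP mg.
apply/measurable_fun_tnthP => l.
have E s : tnth (initial n (f s ++ g s)) l =
    if (l < m)%N then nth 0 (f s) l else nth 0 (g s) (l - m).
  by rewrite tnth_mktuple nth_cat size_tuple.
rewrite (_ : _ \o _ =
  fun s => if (l < m)%N then nth 0 (f s) l else nth 0 (g s) (l - m));
    last by apply/funext => s; exact: E.
case: ltnP => lm.
  have := mf (Ordinal lm); congr measurable_fun.
  by apply/funext => s /=; rewrite (tnth_nth 0).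
have [lk|kl] := ltnP (l - m) k.
  have := mg (Ordinal lk); congr measurable_fun.
  by apply/funext => s /=; rewrite (tnth_nth 0).
rewrite (_ : (fun _ => _) = cst 0); first exact: measurable_cst.
by apply/funext => s; rewrite nth_default // size_tuple.
Qed.

Lemma initial_id n (s : n.-tuple point) : initial n s = s.
Proof. by apply: eq_from_tnth => l; rewrite tnth_mktuple (tnth_nth 0). Qed.

Lemma initial_eq n (s : seq point) (t : n.-tuple point) : s = t -> initial n s = t.
Proof. by move=> ->; exact: initial_id. Qed.
End measurable_configurations.

Section measurable_continuous.
Context (R : realType) (m n : nat).

(* f A is the limit of f (floor((k+1) A) / (k+1)), and these grid points are
   countably many. *)
Lemma measurable_continuous_mx (f : 'M[R]_(m, n) -> R) :
  continuous f -> measurable_fun setT f.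
Proof.
move=> cf.
pose r (k : nat) (A : 'M[R]_(m, n)) : 'M[int]_(m, n) :=
  \matrix_(i, j) Num.floor (k.+1%:R * A i j).
pose c (k : nat) (z : 'M[int]_(m, n)) : 'M[R]_(m, n) :=
  \matrix_(i, j) ((z i j)%:~R / k.+1%:R).
(* The grid is countable, so the preimage of any set [Y] is a countable union of fibres, and each
   fibre is a finite intersection of conditions on single entries. *)
have mr k (Y : set 'M[int]_(m, n)) : measurable (r k @^-1` Y).
  rewrite (_ : _ @^-1` _ = \bigcup_z (r k @^-1` [set z] `&` [set _ | Y z]));
    last first.
    by apply/seteqP; split=> [A YA|A [z _ [/= -> //]]]; exists (r k A).
  apply: countable_bigcupT_measurable => [|z]; first exact: countableP.
  have [Yz|Yz] := pselect (Y z); last first.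
    by rewrite (_ : [set _ | Y z] = set0) ?setI0 // -subset0.
  rewrite (_ : [set _ | Y z] = setT) ?setIT; last by apply/seteqP; split.
  rewrite (_ : _ @^-1` _ = \bigcap_(i in [set: 'I_m]) \bigcap_(j in [set: 'I_n])
     ((fun A : 'M[R]_(m, n) => A i j) @^-1`
       [set a | Num.floor (k.+1%:R * a) = z i j])); last first.
    apply/seteqP; split=> [A /= <- i _ j _|A /= zA]; first by rewrite /= mxE.
    by apply/matrixP => i j; rewrite mxE; exact: zA.
  apply: fin_bigcap_measurable => [|i _]; first exact: finite_finset.
  apply: fin_bigcap_measurable => [|j _]; first exact: finite_finset.
  rewrite -[X in measurable X]setTI; apply: measurable_mx_entry => //.
  rewrite (_ : [set _ | _] =
    `[(z i j)%:~R / k.+1%:R, (z i j + 1)%:~R / k.+1%:R[%classic).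
    exact: measurable_itv.
  apply/seteqP; split=> a /=.
    move=> /eqP; rewrite in_itv /= ler_pdivrMr// ltr_pdivlMr// [a * _]mulrC.
    by rewrite Num.Theory.floor_eq //.
  rewrite in_itv /= ler_pdivrMr// ltr_pdivlMr// [a * _]mulrC => h.
  by apply/eqP; rewrite floor_eq.
apply: (@measurable_fun_cvg _ _ _ _ (fun k A => f (c k (r k A)))) => //.
  move=> k _ Y mY; rewrite setTI.
  exact: (mr k ((f \o c k) @^-1` Y)).
move=> A _; apply: (@cvg_comp _ _ _ (fun k => c k (r k A)) f _ (nbhs A));
  last exact: cf.
apply/cvgrPdist_lt => e e0.
near=> k.
rewrite /Num.norm /= mx_normrE; apply/bigmax_ltP; split=> // -[i j] _.
rewrite !mxE /=.
have k0 : 0 < k.+1%:R :> R by [].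
have -> : A i j - (Num.floor (k.+1%:R * A i j))%:~R / k.+1%:R =
  (k.+1%:R * A i j - (Num.floor (k.+1%:R * A i j))%:~R) / k.+1%:R.
  by rewrite mulrBl [_ * A i j]mulrC mulfK ?gt_eqF.
have /andP[f1 f2] := floor_itv (k.+1%:R * A i j).
rewrite ger0_norm ?divr_ge0 ?subr_ge0//.
rewrite ltr_pdivrMr//.
(* A fractional part is less than 1, so each entry is moved by less than 1/(k+1). *)
apply: (@lt_trans _ _ 1); first by rewrite ltrBlDl -[X in _ + X]/(1%:~R) -intrD.
rewrite -ltr_pdivrMr// div1r.
near: k.
exact: (near_infty_natSinv_lt (PosNum e0)).
Unshelve. all: by end_near. Qed.
End measurable_continuous.

(** * Integration over product measures *)

Section tuple_product_integral.
Context d (T : measurableType d) (R : realType).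
Variable mu : {sigma_finite_measure set T -> \bar R}.
Local Open Scope ereal_scope.

Lemma measurable_tcons1 n (y : T) :
  measurable_fun setT (fun t : n.-tuple T => tcons (y, t)).
Proof.
by apply: (measurableT_comp (@measurable_tcons _ _ n)); exact: measurable_pair1.
Qed.

(** Tonelli, after a change of variables: [tprod mu n.+1] is the image under [tcons] of the product
    of [mu] and [tprod mu n]. *)
Lemma ge0_integral_tprodS n (F : n.+1.-tuple T -> \bar R) :
  measurable_fun setT F -> (forall y, 0 <= F y) ->
  \int[tprod mu n.+1]_y F y =
  \int[mu]_y \int[tprod mu n]_t F (tcons (y, t)).
Proof.
move=> mF F0.
rewrite [LHS](@ge0_integral_pushforward _ _ _ _ _ _ (@measurable_tcons _ _ n)) //.
rewrite preimage_setT [LHS](@fubini_tonelli1 _ _ _ _ _ mu (tprod mu n)) //;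
  last by move=> x; exact: F0.
exact: (measurableT_comp mF (@measurable_tcons _ _ n)).
Qed.

Lemma ge0_measurable_integral_tprod n d' (S : measurableType d')
    (F : S * n.-tuple T -> \bar R) :
  measurable_fun setT F -> (forall y, 0 <= F y) ->
  measurable_fun setT (fun y => \int[tprod mu n]_t F (y, t)).
Proof. by move=> mF F0; exact: measurable_fun_fubini_tonelli_F. Qed.

(** The integrals of the positive and negative parts are measurable by Tonelli, hence so are their
    difference and its image under [fine]; this asks for no integrability of [F]. *)
Lemma measurable_Rintegral_tprod n d' (S : measurableType d')
    (F : S * n.-tuple T -> R) :
  measurable_fun setT F ->
  measurable_fun setT (fun y => \int[tprod mu n]_t F (y, t))%R.
Proof.
move=> /measurable_EFinP mF; apply: measurableT_comp => //.
rewrite (_ : (fun _ => _) = fun y =>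
    (\int[tprod mu n]_t (EFin \o F)^\+ (y, t)
     - \int[tprod mu n]_t (EFin \o F)^\- (y, t))%E); last first.
  apply/funext => y; rewrite integralE.
  by congr (_ - _)%E; apply: eq_integral => t _; rewrite ?funeposE ?funenegE.
apply: emeasurable_funB; apply: ge0_measurable_integral_tprod => //.
- exact: measurable_funepos.
- exact: measurable_funeneg.
Qed.

(** Fubini for real-valued integrals. Integrability of every slice, and not of almost every one,
    makes each inner integral finite, so that [fine] loses nothing at any [y]. *)
Lemma Rintegral_tprodS n (F : n.+1.-tuple T -> R) :
  (tprod mu n.+1).-integrable setT (EFin \o F) ->
  (forall y, (tprod mu n).-integrable setT (fun t => (F (tcons (y, t)))%:E)) ->
  (\int[tprod mu n.+1]_y F y = \int[mu]_y \int[tprod mu n]_t F (tcons (y, t)))%R.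
Proof.
move=> iF iFy; rewrite /Rintegral; congr fine.
have mF : measurable_fun setT (EFin \o F) by case/integrableP: iF.
have mFc : measurable_fun setT ((EFin \o F) \o @tcons _ T n).
  exact: measurableT_comp mF (@measurable_tcons _ _ n).
have iFc : (sfprod mu (tprod mu n)).-integrable setT ((EFin \o F) \o @tcons _ T n).
  apply/integrableP; split => //; case/integrableP: iF => _.
  rewrite [X in X < _ -> _](@ge0_integral_pushforward _ _ _ _ _ _
    (@measurable_tcons _ _ n)) //.
  exact: measurableT_comp.
rewrite [LHS](@integral_pushforward _ _ _ _ _ _ (@measurable_tcons _ _ n)) //.
rewrite preimage_setT -[LHS](@integral12_prod_meas1 _ _ _ _ _ mu (tprod mu n)) //.
apply: eq_integral => y _; rewrite fineK //.
exact: (integrable_fin_num measurableT (iFy y)).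
Qed.

Lemma tprod_setT n : mu setT = 1 -> tprod mu n setT = 1.
Proof.
move=> mu1; elim: n => [|n IH]; first by rewrite /= diracT.
rewrite /= /transport /pushforward preimage_setT /sfprod -setXTT.
by rewrite product_measure1E// -[RHS]mule1; congr (_ * _).
Qed.
End tuple_product_integral.

Section torus.
Context (R : realType) (d : nat).

Lemma cvprod_setT d' (T : measurableType d')
    (mu : {sigma_finite_measure set T -> \bar R}) :
  mu setT = 1%E -> cvprod d mu setT = 1%E.
Proof. by move=> mu1; exact: (@tprod_setT _ _ _ mu d mu1). Qed.

Lemma torus_measure_setT : torus_measure R d setT = 1%E.
Proof.
by apply: cvprod_setT; exact: (probability_setT (uniform_prob (@ltr01 R))).
Qed.

Lemma torus_power_setT n : tprod (torus_measure R d) n setT = 1%E.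
Proof. by apply: tprod_setT; exact: torus_measure_setT. Qed.
End torus.

Section mass_one.
Context d (T : measurableType d) (R : realType) (mu : {measure set T -> \bar R}).
Hypothesis mu1 : mu setT = 1%E.

Lemma integrable_le_bound (f : T -> R) (M : R) :
  measurable_fun setT f -> (forall x, `|f x| <= M) ->
  mu.-integrable setT (EFin \o f).
Proof.
move=> mf fM; apply: measurable_bounded_integrable => //.
  by rewrite mu1 ltry.
exists M; split; first exact: num_real.
by move=> x Mx y _; exact: le_trans (fM y) (ltW Mx).
Qed.

Lemma integrable_mass_one_cst (c : R) : mu.-integrable setT (EFin \o cst c).
Proof. exact: (@integrable_le_bound _ `|c|). Qed.

Lemma Rintegral_mass_one_cst (c : R) : \int[mu]_x c = c.
Proof. by rewrite Rintegral_cst// mu1 mulr1. Qed.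
End mass_one.

Section Rintegral_sum.
Context d (T : measurableType d) (R : realType) (mu : {measure set T -> \bar R}).

Lemma integrable_Rsum (I : Type) (s : seq I) (f : I -> T -> R) :
  (forall i, mu.-integrable setT (EFin \o f i)) ->
  mu.-integrable setT (EFin \o (fun x => \sum_(i <- s) f i x)).
Proof.
move=> fi; rewrite (_ : _ \o _ = fun x => (\sum_(i <- s) (EFin \o f i) x)%E).
  by apply: integrable_sum => // i _; exact: fi.
by apply/funext => x /=; rewrite sumEFin.
Qed.

Lemma Rintegral_sum (I : Type) (s : seq I) (f : I -> T -> R) :
  (forall i, mu.-integrable setT (EFin \o f i)) ->
  \int[mu]_x (\sum_(i <- s) f i x) = \sum_(i <- s) \int[mu]_x f i x.
Proof.
move=> fi; elim: s => [|i s IH].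
  by under eq_Rintegral do rewrite big_nil; rewrite Rintegral_cst// mul0r big_nil.
under eq_Rintegral do rewrite big_cons.
by rewrite RintegralD// ?IH ?big_cons//; exact: integrable_Rsum.
Qed.

Lemma integrable_Rzl (c : R) (f : T -> R) :
  mu.-integrable setT (EFin \o f) -> mu.-integrable setT (EFin \o (fun x => c * f x)).
Proof.
move=> fi; rewrite (_ : _ \o _ = fun x => (c%:E * (EFin \o f) x)%E).
  exact: integrableZl.
by apply/funext => x /=; rewrite EFinM.
Qed.

Lemma integrable_Rzr (c : R) (f : T -> R) :
  mu.-integrable setT (EFin \o f) -> mu.-integrable setT (EFin \o (fun x => f x * c)).
Proof. by move=> fi; under eq_fun do rewrite mulrC; exact: integrable_Rzl. Qed.

Lemma integrable_RD (f g : T -> R) :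
  mu.-integrable setT (EFin \o f) -> mu.-integrable setT (EFin \o g) ->
  mu.-integrable setT (EFin \o (fun x => f x + g x)).
Proof.
move=> fi gi; rewrite (_ : _ \o _ = ((EFin \o f) \+ (EFin \o g))%E).
  exact: integrableD.
by apply/funext => x /=; rewrite EFinD.
Qed.

Lemma integrable_dominated (f g : T -> R) : measurable_fun setT f ->
  (forall x, `|f x| <= g x) -> mu.-integrable setT (EFin \o g) ->
  mu.-integrable setT (EFin \o f).
Proof.
move=> mf fg; apply: le_integrable => //; first exact/measurable_EFinP.
by move=> x _ /=; rewrite lee_fin (le_trans (fg x)) ?ler_norm.
Qed.
End Rintegral_sum.

(** * Quadratic energies of square-integrable fields *)

Section dot_theory.
Context (R : realType) (n : nat).
Implicit Types (u v w : 'cV[R]_n) (A : 'M[R]_n).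

Lemma dotE u w : dot u w = (u^T *m w) 0 0.
Proof. by rewrite mxE; apply: eq_bigr => i _; rewrite mxE. Qed.

Lemma dotC u w : dot u w = dot w u.
Proof. by apply: eq_bigr => i _; rewrite mulrC. Qed.

Lemma dotDl u v w : dot (u + v) w = dot u w + dot v w.
Proof. by rewrite !dotE linearD mulmxDl mxE. Qed.

Lemma dotDr u v w : dot u (v + w) = dot u v + dot u w.
Proof. by rewrite !dotE mulmxDr mxE. Qed.

Lemma dotNl u w : dot (- u) w = - dot u w.
Proof. by rewrite !dotE linearN mulNmx mxE. Qed.

Lemma dotNr u w : dot u (- w) = - dot u w.
Proof. by rewrite !dotE mulmxN mxE. Qed.

Lemma dotZr (c : R) u w : dot u (c *: w) = c * dot u w.
Proof. by rewrite !dotE -scalemxAr mxE. Qed.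

Lemma dot_trmx A u w : dot u (A *m w) = dot (A^T *m u) w.
Proof. by rewrite !dotE trmx_mul trmxK mulmxA. Qed.

Lemma dot_ge0 u : 0 <= dot u u.
Proof. by apply: sumr_ge0 => i _; rewrite -expr2 sqr_ge0. Qed.

Lemma dot_delta A i j : dot (delta_mx i 0) (A *m delta_mx j 0) = A i j.
Proof. by rewrite dotE trmx_delta -rowE -colE !mxE. Qed.

Lemma matrix_dotP A B : (forall u w, dot u (A *m w) = dot u (B *m w)) -> A = B.
Proof. by move=> AB; apply/matrixP => i j; rewrite -dot_delta AB dot_delta. Qed.

Lemma sqr_entry_le_dot u i : u i 0 ^+ 2 <= dot u u.
Proof.
rewrite /dot (bigD1 i) //= -expr2 lerDl.
by apply: sumr_ge0 => j _; rewrite -expr2 sqr_ge0.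
Qed.
End dot_theory.

Section square_integrable_fields.
Context d (T : measurableType d) (R : realType) (mu : {measure set T -> \bar R}).
Context (n : nat).
Implicit Types (f g : T -> 'cV[R]_n).

Definition square_integrable f := measurable_fun setT f /\
  mu.-integrable setT (fun y => (dot (f y) (f y))%:E).

Lemma square_integrableD f g : square_integrable f -> square_integrable g ->
  square_integrable (fun y => f y + g y).
Proof.
move=> [mf fi] [mg gi].
have mfg : measurable_fun setT (fun y => f y + g y) by exact: measurable_addmx.
split => //.
apply: (@integrable_dominated _ _ _ _ (fun y => dot (f y + g y) (f y + g y))
  (fun y => 2 * dot (f y) (f y) + 2 * dot (g y) (g y))).
- exact: measurable_dot.
- move=> y; rewrite ger0_norm ?dot_ge0//.
  (* With |f - g|^2 >= 0 this is |f + g|^2 <= 2 |f|^2 + 2 |g|^2. *)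
  have := dot_ge0 (f y - g y).
  rewrite !(dotDl, dotDr, dotNl, dotNr) [dot (g y) (f y)]dotC; lra.
- by apply: integrable_RD; exact: integrable_Rzl.
Qed.

Lemma square_integrableN f : square_integrable f ->
  square_integrable (fun y => - f y).
Proof.
move=> [mf fi]; split; first exact: measurable_oppmx.
by under eq_fun do rewrite dotNl dotNr opprK.
Qed.

Lemma square_integrable_cst u : mu setT = 1%E -> square_integrable (fun=> u).
Proof. by move=> mu1; split => //; exact: (integrable_mass_one_cst mu1). Qed.

Lemma square_integrable_Lfun2 f : measurable_fun setT f ->
  (forall a, (fun y => f y a ord0) \in Lfun mu 2%:E) -> square_integrable f.
Proof.
move=> mf fL; split=> //.
apply: (@integrable_Rsum _ _ _ _ _ _ (fun i y => f y i ord0 * f y i ord0)) => i.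
exact: Lfun2_integrable_sqr (fL i).
Qed.

Section coefficient.
Variables (K : T -> 'M[R]_n) (beta : R).
Hypotheses (mK : measurable_fun setT K) (Ksym : forall y, (K y)^T = K y).
Hypothesis K_ge0 : forall y u, 0 <= dot u (K y *m u).
Hypothesis K_le : forall y u, dot u (K y *m u) <= beta * dot u u.

(** Positivity of [K] at f + g and f - g gives 2 |f . K g| <= f . K f + g . K g, and the right-hand
    side is at most beta (|f|^2 + |g|^2). *)
Lemma integrable_energy_form f g : square_integrable f -> square_integrable g ->
  mu.-integrable setT (fun y => (dot (f y) (K y *m g y))%:E).
Proof.
move=> [mf fi] [mg gi].
apply: (@integrable_dominated _ _ _ _ (fun y => dot (f y) (K y *m g y))
  (fun y => beta * dot (f y) (f y) + beta * dot (g y) (g y))).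
- by apply: measurable_dot => //; exact: measurable_mulmx.
- move=> y.
  have gf : dot (g y) (K y *m f y) = dot (f y) (K y *m g y).
    by rewrite dot_trmx Ksym dotC.
  have := K_ge0 y (f y - g y); have := K_ge0 y (f y + g y).
  rewrite !(mulmxDr, mulmxN, dotDl, dotDr, dotNl, dotNr) gf.
  have := K_le y (f y); have := K_le y (g y).
  have := K_ge0 y (f y); have := K_ge0 y (g y).
  by rewrite ler_norml; lra.
- by apply: integrable_RD; exact: integrable_Rzl.
Qed.

Lemma energy_form_sym f g :
  \int[mu]_y dot (f y) (K y *m g y) = \int[mu]_y dot (g y) (K y *m f y).
Proof. by apply: eq_Rintegral => y _; rewrite dot_trmx Ksym dotC. Qed.

Lemma energy_formDl f g h :
  square_integrable f -> square_integrable g -> square_integrable h ->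
  \int[mu]_y dot (f y + g y) (K y *m h y) =
  \int[mu]_y dot (f y) (K y *m h y) + \int[mu]_y dot (g y) (K y *m h y).
Proof.
move=> fi gi hi; rewrite -RintegralD//; try exact: integrable_energy_form.
by apply: eq_Rintegral => y _; rewrite dotDl.
Qed.

Lemma energy_formDr f g h :
  square_integrable f -> square_integrable g -> square_integrable h ->
  \int[mu]_y dot (f y) (K y *m (g y + h y)) =
  \int[mu]_y dot (f y) (K y *m g y) + \int[mu]_y dot (f y) (K y *m h y).
Proof.
move=> fi gi hi.
rewrite energy_form_sym energy_formDl// energy_form_sym; congr (_ + _).
exact: energy_form_sym.
Qed.

(** When the square is expanded, the cross terms vanish by orthogonality and symmetry; the energy of
    [h] that remains is nonnegative. *)
Lemma dirichlet_principle w h :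
  square_integrable w -> square_integrable h ->
  \int[mu]_y dot (h y) (K y *m w y) = 0 ->
  \int[mu]_y dot (w y) (K y *m w y) <=
  \int[mu]_y dot (w y + h y) (K y *m (w y + h y)).
Proof.
move=> wi hi hw0.
have whi := square_integrableD wi hi.
rewrite energy_formDr// !energy_formDl// hw0 [X in _ + (X + _)]energy_form_sym hw0.
rewrite addr0 add0r lerDl; apply: Rintegral_ge0 => y _; exact: K_ge0.
Qed.
End coefficient.
End square_integrable_fields.

(** * Sobolev functions on the torus *)

Section periodic_functions.
Context (R : realType) (d : nat).
Local Notation point := 'cV[R]_d.

Lemma continuous_trmx m n : continuous (@trmx R m n).
Proof.
move=> A B [P AP PB]; exists (fun i j => P j i) => [i j|C PC].
  by have := AP j i; rewrite mxE.
by apply: PB => i j; rewrite mxE; exact: PC.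
Qed.

(* Every value is taken on the compact cube [0, 1]^d. *)
Lemma periodic_continuous_bounded (f : point -> R) :
  continuous f -> periodic f -> exists M, forall x, `|f x| <= M.
Proof.
move=> cf pf.
pose Q : set 'rV[R]_d := [set u | forall i, `[0, 1]%classic (u ord0 i)].
(* The cube is compact as a product of segments in the space of row vectors; transposition, which is
   continuous, brings it back to points. *)
have cQ : compact Q.
  exact: (@rV_compact R d (fun=> `[0, 1]%classic) (fun=> @segment_compact R 0 1)).
have : compact ((f \o trmx) @` Q).
  have cft : continuous (f \o trmx : 'rV[R]_d -> R).
    by move=> u; apply: continuous_comp; [exact: continuous_trmx|exact: cf].
  by apply: continuous_compact => //; exact: continuous_subspaceT.
move=> /compact_bounded[M [_ HM]]; exists (M + 1) => x.
(* Subtracting integer parts brings x into the cube. *)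
pose z : 'cV[int]_d := \col_i - Num.floor (x i ord0).
rewrite -(pf x z); apply: (HM (M + 1)); first by rewrite ltrDl.
exists (x + map_mx intr z)^T; last by rewrite /= trmxK.
move=> i; rewrite /= !mxE in_itv /= rmorphN /=.
have /andP[h1 h2] := floor_itv (x i ord0).
by rewrite subr_ge0 h1 /= lerBlDl -[X in _ + X]/(1%:~R) -intrD ltW.
Qed.

Lemma periodic_partial (f : point -> R) a : periodic f ->
  periodic (fun y => partial a f y).
Proof.
move=> pf x z; rewrite /derive pf.
rewrite (_ : (fun h : R => _) =
  fun h => h^-1 *: (f (h *: delta_mx a ord0 + x) - f x)) //.
by apply/funext => h /=; rewrite addrA pf.
Qed.

Lemma smooth_partial_continuous (f : point -> R) a : smooth f ->
  continuous (fun y => partial a f y).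
Proof. by move=> /(_ 1%N (delta_mx a ord0))[]. Qed.
End periodic_functions.

Section H1_theory.
Context (R : realType) (d : nat).
Local Notation point := 'cV[R]_d.
Local Notation T1 := (torus_measure R d).

Lemma integrable_Lfun2_bounded (v f : point -> R) M :
  v \in Lfun T1 2%:E -> measurable_fun setT f -> (forall x, `|f x| <= M) ->
  T1.-integrable setT (EFin \o (fun y => v y * f y)).
Proof.
move=> vL mf fM.
have mv : measurable_fun setT v.
  by move: vL; rewrite inE => /andP[/[!inE]].
(* From (|v| - 1)^2 >= 0 comes |v| <= v^2 + 1, which is integrable since the torus has mass 1. *)
apply: (@integrable_dominated _ _ _ _ _ (fun y => M * (v y ^+ 2 + 1))).
- exact: measurable_funM.
- move=> y; rewrite normrM [leLHS]mulrC ler_pM//.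
  by have := sqr_ge0 (`|v y| - 1); rewrite -[v y ^+ 2]real_normK ?num_real//; nra.
- apply: integrable_Rzl; apply: integrable_RD; first exact: Lfun2_integrable_sqr.
  exact: (integrable_mass_one_cst (torus_measure_setT R d)).
Qed.

(** This turns the components of theta_k into theta_k . u, and with an empty [s] it provides the
    zero function. Periodic smooth test functions and their derivatives are bounded, so every
    product in the weak formula is integrable and the integrals are additive. *)
Lemma is_H1_lin (I : Type) (s : seq I) (c : I -> R) (v : I -> point -> R)
    (g : I -> point -> point) : (forall b, is_H1 (v b) (g b)) ->
  is_H1 (fun y => \sum_(b <- s) c b * v b y) (fun y => \sum_(b <- s) c b *: g b y).
Proof.
move=> vg; have le12 : (1 <= 2%:E :> \bar R)%E by rewrite lee_fin ler1n.
have Lsum (w : I -> point -> R) : (forall b, w b \in Lfun T1 2%:E) ->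
    (fun y => \sum_(b <- s) c b * w b y) \in Lfun T1 2%:E.
  move=> wL; rewrite (_ : (fun _ => _) = \sum_(b <- s) (c b *: w b)).
    by apply: rpred_sum => b _; apply: rpredZ; exact: wL.
  by apply/funext => y; rewrite fct_sumE.
split.
- by move=> x z; apply: eq_bigr => b _; rewrite (H1_periodic (vg b)).
- by move=> x z; apply: eq_bigr => b _; rewrite (H1_grad_periodic (vg b)).
- by apply: Lsum => b; exact: H1_L2 (vg b).
- move=> a; rewrite (_ : (fun _ => _) = fun y => \sum_(b <- s) c b * g b y a ord0).
    by apply: (Lsum (fun b y => g b y a ord0)) => b; exact: H1_grad_L2 (vg b) a.
  by apply/funext => y; rewrite summxE; apply: eq_bigr => b _; rewrite mxE.
- move=> phi sphi pphi a.
  have cphi : continuous phi := sphi 0%N.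
  have cdphi := smooth_partial_continuous (a := a) sphi.
  have [M phiM] := periodic_continuous_bounded cphi pphi.
  have [M' dphiM] := periodic_continuous_bounded cdphi (periodic_partial a pphi).
  under eq_Rintegral do rewrite mulr_suml.
  under [in RHS]eq_Rintegral do rewrite summxE mulr_suml.
  have iv b : T1.-integrable setT (EFin \o (fun y => v b y * partial a phi y)).
    apply: integrable_Lfun2_bounded dphiM; first exact: H1_L2 (vg b).
    exact: measurable_continuous_mx.
  have ig b : T1.-integrable setT (EFin \o (fun y => g b y a ord0 * phi y)).
    apply: integrable_Lfun2_bounded phiM; first exact: H1_grad_L2 (vg b) a.
    exact: measurable_continuous_mx.
  rewrite (@Rintegral_sum _ _ _ _ _ _
    (fun b y => c b * v b y * partial a phi y)); last first.
    by move=> b; under eq_fun do rewrite -mulrA; exact: integrable_Rzl.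
  rewrite (@Rintegral_sum _ _ _ _ _ _
    (fun b y => (c b *: g b y) a ord0 * phi y)); last first.
    by move=> b; under eq_fun do rewrite mxE -mulrA; exact: integrable_Rzl.
  rewrite -sumrN; apply: eq_bigr => b _.
  under eq_Rintegral do rewrite -mulrA.
  under [in RHS]eq_Rintegral do rewrite mxE -mulrA.
  by rewrite !RintegralZl// (H1_weak (vg b)) // mulrN.
Qed.

Lemma square_integrable_grad (v : point -> R) (g : point -> point) :
  is_H1 v g -> square_integrable T1 g.
Proof.
move=> vg; apply: square_integrable_Lfun2; last first.
  by move=> a; exact: H1_grad_L2 vg a.
apply/measurable_mxP => a j; rewrite ord1.
by have := H1_grad_L2 vg a; rewrite inE => /andP[/[!inE]].
Qed.
End H1_theory.

(** * The tensors as energies *)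

Section homogenized_tensor.
Context (R : realType) (d N : nat) (sigma : R).
Local Notation point := 'cV[R]_d.
Local Notation T1 := (torus_measure R d).
Local Notation torus_power n := (tprod (torus_measure R d) n).
Variable V : N.+1.-tuple point -> R.
Variables (theta : forall k, k.+1.-tuple point -> point).
Variables (Dtheta : forall k, k.+1.-tuple point -> 'M[R]_d).
Arguments theta : clear implicits.
Arguments Dtheta : clear implicits.
Hypothesis mV : measurable_fun setT V.
Hypothesis cell : forall k : nat, (1 <= k <= N)%N ->
  cell_solution sigma V theta Dtheta k.
Variable B : point -> R.

(** Configurations are plain sequences here, so that moving a variable from the integrated ones to
    the fixed ones changes no type. *)
Definition weight (s : seq point) : R := expR (- V (initial N.+1 s) / sigma).

(** The bound may depend on x_0, which stays fixed in every integral. *)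
Hypothesis weight_le : forall k (x : k.+1.-tuple point) (s : seq point),
  weight (x ++ s) <= B (thead x).

Lemma weight_ge0 s : 0 <= weight s.
Proof. exact: expR_ge0. Qed.

(** The product (I + D theta_n) ... (I + D theta_{n-m+1}). The tensors use n = N; the minimizer
    needs chains that start at a lower level. *)
Definition partial_chain (n m : nat) (s : seq point) : 'M[R]_d :=
  \big[mulmx/1%:M]_(l < m) (1%:M + Dtheta (n - l) (initial (n - l).+1 s)).

Local Notation chain := (partial_chain N).

(* [tensor] with m in place of N - k, which makes induction on m possible. *)
Definition tensor_rest m k (x : k.+1.-tuple point) : 'M[R]_d :=
  \matrix_(a, b) \int[torus_power m]_y (chain m (x ++ y) a b * weight (x ++ y)).

Lemma tensorE m k (x : k.+1.-tuple point) : (k + m)%N = N ->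
  tensor sigma V Dtheta x = tensor_rest m x.
Proof.
move=> kmN; have <- : (N - k)%N = m by rewrite -kmN addKn.
by [].
Qed.

Definition extend k (x : k.-tuple point) (y : point) : k.+1.-tuple point :=
  [tuple of rcons x y].

(** The first integrated variable can be counted as the last fixed one; this is how one integration
    is peeled off. *)
Lemma cat_tcons k (x : k.+1.-tuple point) m (y : point) (t : m.-tuple point) :
  x ++ tcons (y, t) = extend x y ++ t :> seq point.
Proof. by rewrite /= cat_rcons. Qed.

Lemma thead_extend k (x : k.+1.-tuple point) y : thead (extend x y) = thead x.
Proof. by rewrite /thead !(tnth_nth 0) /= nth_rcons size_tuple. Qed.

Lemma initial_extend_cat k (x : k.-tuple point) y s :
  initial k.+1 (extend x y ++ s) = extend x y.
Proof.
apply: eq_from_tnth => l; rewrite tnth_mktuple nth_cat size_tuple ltn_ord.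
by rewrite (tnth_nth 0).
Qed.

(** The rightmost factor, of level k+1, reads only the variables up to x_{k+1}, so it is constant in
    the variables that are still to be integrated. *)
Lemma chain_extend m k (x : k.+1.-tuple point) y s : (k + m.+1)%N = N ->
  chain m.+1 (extend x y ++ s) =
  chain m (extend x y ++ s) *m (1%:M + Dtheta k.+1 (extend x y)).
Proof.
move=> kmN; rewrite /partial_chain big_ord_recr /=; congr (_ *m (_ + _)).
have -> : (N - m)%N = k.+1 by rewrite -kmN addnS -addSn addnK.
by rewrite -(initial_extend_cat x y s).
Qed.

Lemma measurable_chain n m d' (S : measurableType d') p q
    (f : S -> p.-tuple point) (g : S -> q.-tuple point) :
  (m <= n <= N)%N -> measurable_fun setT f -> measurable_fun setT g ->
  measurable_fun setT (fun s => partial_chain n m (f s ++ g s)).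
Proof.
move=> /andP[mn nN] mf mg; apply: measurable_prodmx => l.
apply: measurable_addmx => //.
apply: (measurableT_comp (f := Dtheta (n - l))); last exact: measurable_initial_cat.
apply: Dtheta_measurable; first apply: cell.
by rewrite subn_gt0 (leq_trans (ltn_ord l))// (leq_trans (leq_subr _ _)).
Qed.

Lemma measurable_weight d' (S : measurableType d') n n'
    (f : S -> n.-tuple point) (g : S -> n'.-tuple point) :
  measurable_fun setT f -> measurable_fun setT g ->
  measurable_fun setT (fun s => weight (f s ++ g s)).
Proof.
move=> mf mg; apply: measurableT_comp; first exact: measurable_expR.
apply: measurable_funM => //; apply: measurableT_comp => //.
apply: measurableT_comp => //; exact: measurable_initial_cat.
Qed.

Lemma measurable_extend k (x : k.-tuple point) : measurable_fun setT (extend x).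
Proof.
apply/measurable_fun_tnthP => l.
have [lk|kl] := ltnP l k.
  rewrite (_ : _ \o _ = cst (nth 0 x l)); first exact: measurable_cst.
  by apply/funext => y; rewrite /= (tnth_nth 0) /= nth_rcons size_tuple lk.
rewrite (_ : _ \o _ = id); first exact: measurable_id.
apply/funext => y; rewrite /= (tnth_nth 0) /= nth_rcons size_tuple ltnNge kl /=.
by rewrite eqn_leq kl -ltnS ltn_ord.
Qed.

Lemma measurable_tensor_rest m k (x : k.-tuple point) : (k + m)%N = N ->
  measurable_fun setT (fun y => tensor_rest m (extend x y)).
Proof.
move=> kmN; apply/measurable_mxP => a b.
under eq_fun do rewrite mxE.
pose F (p : point * m.-tuple point) :=
  chain m (extend x p.1 ++ p.2) a b * weight (extend x p.1 ++ p.2).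
have mx : measurable_fun setT (fun p : point * m.-tuple point => extend x p.1).
  by apply: measurableT_comp => //; exact: measurable_extend.
apply: (@measurable_Rintegral_tprod _ _ _ _ _ _ _ F).
apply: measurable_funM; last exact: measurable_weight.
have : measurable_fun setT
    (fun p : point * m.-tuple point => chain m (extend x p.1 ++ p.2)).
  by apply: measurable_chain => //; rewrite -kmN leq_addl leqnn.
by move/measurable_mxP.
Qed.

Definition energy_density m (s : seq point) (u : point) : R :=
  dot (chain m s *m u) (chain m s *m u) * weight s.

Lemma energy_density_ge0 m s u : 0 <= energy_density m s u.
Proof. by rewrite mulr_ge0 ?dot_ge0 ?weight_ge0. Qed.

(** The invariant of the backward induction. The first field is an equality of extended reals and so
    contains the finiteness of the energy, from which both nonnegativity and integrability of the
    entries are drawn. *)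
Record represents_energy m k (x : k.+1.-tuple point) : Prop := {
  energy_tensor : forall u, (\int[torus_power m]_y (energy_density m (x ++ y) u)%:E
    = (dot u (tensor_rest m x *m u))%:E)%E ;
  tensor_sym : (tensor_rest m x)^T = tensor_rest m x ;
  tensor_le : forall u, dot u (tensor_rest m x *m u) <= B (thead x) * dot u u }.

Lemma tensor_ge0 m k (x : k.+1.-tuple point) : represents_energy m x ->
  forall u, 0 <= dot u (tensor_rest m x *m u).
Proof.
move=> rx u; rewrite -lee_fin -(energy_tensor rx); apply: integral_ge0 => y _.
by rewrite lee_fin energy_density_ge0.
Qed.

Lemma measurable_energy_density m k (x : k.+1.-tuple point) u : (k + m)%N = N ->
  measurable_fun setT (fun y : m.-tuple point => energy_density m (x ++ y) u).
Proof.
move=> kmN; apply: measurable_funM; last exact: measurable_weight.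
by apply: measurable_dot; apply: measurable_mulmx => //;
  apply: measurable_chain => //; rewrite -kmN leq_addl leqnn.
Qed.

(** Column b of the chain P is P e_b, so |P_ab| <= P_ab^2 + 1 <= |P e_b|^2 + 1. Multiplied by the
    weight, the first term has finite energy and the second is bounded on a space of mass 1. *)
Lemma integrable_chain_weight m k (x : k.+1.-tuple point) a b : (k + m)%N = N ->
  (forall u, exists r, (\int[torus_power m]_y (energy_density m (x ++ y) u)%:E
    = r%:E)%E) ->
  (torus_power m).-integrable setT
    (EFin \o fun y => chain m (x ++ y) a b * weight (x ++ y)).
Proof.
move=> kmN Efin; set u := delta_mx b (0 : 'I_1) : point.
apply: (@integrable_dominated _ _ _ _ _
  (fun y : m.-tuple point => energy_density m (x ++ y) u + weight (x ++ y))).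
- apply: measurable_funM; last exact: measurable_weight.
  have : measurable_fun setT (fun y : m.-tuple point => chain m (x ++ y)).
    by apply: measurable_chain => //; rewrite -kmN leq_addl leqnn.
  by move/measurable_mxP.
- move=> y; rewrite normrM (ger0_norm (weight_ge0 _)) /energy_density.
  rewrite -[X in _ + X]mul1r -mulrDl ler_wpM2r ?weight_ge0//.
  have := sqr_entry_le_dot (chain m (x ++ y) *m u) a.
  rewrite -colE mxE => h; apply: le_trans (_ : _ <= chain m (x ++ y) a b ^+ 2 + 1) _.
    rewrite -[_ ^+ 2]real_normK ?num_real//.
    by have := sqr_ge0 (`|chain m (x ++ y) a b| - 1); nra.
  by rewrite lerD2r.
- apply: integrable_RD.
    apply/integrableP; split.
      by apply/measurable_EFinP; exact: measurable_energy_density.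
    have [r Er] := Efin u.
    rewrite (eq_integral
      (fun y : m.-tuple point => (energy_density m (x ++ y) u)%:E)).
      by rewrite Er ltry.
    by move=> y _; rewrite /= ger0_norm ?energy_density_ge0.
  apply: (integrable_le_bound (torus_power_setT R d m) (M := B (thead x))).
    exact: measurable_weight.
  by move=> y; rewrite ger0_norm ?weight_ge0.
Qed.

Lemma energy_densityS m k (x : k.+1.-tuple point) u y (t : m.-tuple point) :
  (k + m.+1)%N = N ->
  energy_density m.+1 (x ++ tcons (y, t)) u =
  energy_density m (extend x y ++ t) (Dtheta k.+1 (extend x y) *m u + u).
Proof.
move=> kmN; rewrite /energy_density cat_tcons chain_extend// -!mulmxA.
by rewrite mulmxDl mul1mx [u + _]addrC.
Qed.

(** Since the entry (a, b) of D theta is the derivative of theta_b along a, the gradient of theta .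
    u is D theta u, without a transpose. *)
Lemma is_H1_theta k (p : k.-tuple point) u : (1 <= k <= N)%N ->
  is_H1 (fun y => dot (theta k (extend p y)) u)
        (fun y => Dtheta k (extend p y) *m u).
Proof.
move=> kN.
have := is_H1_lin (index_enum 'I_d) (fun b => u b ord0) (theta_H1 (cell kN) p).
congr (is_H1 _ _); apply/funext => y.
  by apply: eq_bigr => b _; rewrite mulrC.
apply/colP => a; rewrite summxE mxE; apply: eq_bigr => b _.
by rewrite !mxE mulrC.
Qed.

(** * One step of the backward recursion, from level k+1 to level k *)

Section step.
Context (m k : nat) (x : k.+1.-tuple point).
Hypotheses (kmN : (k + m.+1)%N = N).
Hypothesis IH : forall y, represents_energy m (extend x y).

Let D y := Dtheta k.+1 (extend x y).
Let K y := tensor_rest m (extend x y).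
Let beta := B (thead x).
(** The corrected field u + grad(theta_{k+1} . u) of the cell problem. *)
Let w (u : point) y := D y *m u + u.

Let kmN' : (k.+1 + m)%N = N. Proof. by rewrite addSnnS. Qed.

Let kN : (1 <= k.+1 <= N)%N. Proof. by rewrite /= -kmN' leq_addr. Qed.

Let cellk : cell_solution sigma V theta Dtheta k.+1. Proof. exact: cell. Qed.

Let mK : measurable_fun setT K. Proof. exact: measurable_tensor_rest. Qed.

Let Ksym y : (K y)^T = K y. Proof. exact: tensor_sym (IH y). Qed.

Let K_ge0 y u : 0 <= dot u (K y *m u). Proof. exact: tensor_ge0 (IH y) u. Qed.

Let K_le y u : dot u (K y *m u) <= beta * dot u u.
Proof. by rewrite /beta -(thead_extend x y); exact: tensor_le (IH y) u. Qed.

Lemma sqint_D u : square_integrable T1 (fun y => D y *m u).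
Proof. exact: square_integrable_grad (is_H1_theta x u kN). Qed.

Lemma sqint_cst u : square_integrable T1 (fun=> u : point).
Proof. exact: square_integrable_cst (torus_measure_setT R d). Qed.

Lemma sqint_w u : square_integrable T1 (w u).
Proof. exact: square_integrableD (sqint_D u) (sqint_cst u). Qed.

Lemma weak_cell v g u : is_H1 v g -> \int[T1]_y dot (g y) (K y *m w u y) = 0.
Proof.
move=> vg; rewrite -(theta_weak cellk x u vg).
by apply: eq_Rintegral => y _; rewrite dotC (tensorE _ kmN').
Qed.

Let form_int f g :=
  integrable_energy_form mK Ksym K_ge0 K_le (mu := T1) (f := f) (g := g).

Let form_Dl f g h :=
  energy_formDl mK Ksym K_ge0 K_le (mu := T1) (f := f) (g := g) (h := h).

(** By Tonelli, the integral over the last m variables is the quadratic form of [K y] at [w u y], by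
    the invariant at level k+1. It is integrable in y because [K] is bounded and [w u] is
    square-integrable, so the total energy is finite. *)
Lemma energy_integral_step u :
  (\int[torus_power m.+1]_y (energy_density m.+1 (x ++ y) u)%:E =
   (\int[T1]_y dot (w u y) (K y *m w u y))%:E)%E.
Proof.
rewrite ge0_integral_tprodS; last 2 first.
- by apply/measurable_EFinP; exact: measurable_energy_density.
- by move=> y; rewrite lee_fin energy_density_ge0.
under eq_integral => y _.
  under eq_integral do rewrite energy_densityS//.
  rewrite (energy_tensor (IH y)).
  over.
rewrite /Rintegral fineK //.
exact: (integrable_fin_num measurableT (form_int (sqint_w u) (sqint_w u))).
Qed.

(** This is K_k = int K_{k+1} (I + D theta_{k+1}) dx_{k+1}, obtained by Fubini entry by entry.
    Integrability over all the variables comes from [energy_integral_step], and on each slice from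
    [IH]. *)
Lemma tensor_rest_step u v :
  dot u (tensor_rest m.+1 x *m v) = \int[T1]_y dot u (K y *m w v y).
Proof.
have wE z y : w z y = (1%:M + D y) *m z by rewrite mulmxDl mul1mx addrC.
have entry a b : tensor_rest m.+1 x a b = \int[T1]_y (K y *m (1%:M + D y)) a b.
  rewrite mxE Rintegral_tprodS; last 2 first.
  - apply: integrable_chain_weight => // z.
    by rewrite energy_integral_step; eexists.
  - move=> y.
    under eq_fun do rewrite cat_tcons chain_extend// mxE mulr_suml.
    apply: (@integrable_Rsum _ _ _ _ _ _ (fun c (t : m.-tuple point) =>
      chain m (extend x y ++ t) a c * (1%:M + D y) c b * weight (extend x y ++ t))) => c.
    under eq_fun do rewrite mulrAC.
    apply: integrable_Rzr; apply: integrable_chain_weight => // z.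
    by rewrite (energy_tensor (IH y)); eexists.
  apply: eq_Rintegral => y _.
  under eq_Rintegral do rewrite cat_tcons chain_extend// mxE mulr_suml.
  have iy c : (torus_power m).-integrable setT
      (EFin \o fun t : m.-tuple point =>
        chain m (extend x y ++ t) a c * weight (extend x y ++ t)).
    apply: integrable_chain_weight => // z.
    by rewrite (energy_tensor (IH y)); eexists.
  rewrite (@Rintegral_sum _ _ _ _ _ _ (fun c (t : m.-tuple point) =>
      chain m (extend x y ++ t) a c * (1%:M + D y) c b * weight (extend x y ++ t)));
    last first.
    by move=> c; under eq_fun do rewrite mulrAC; exact: integrable_Rzr.
  rewrite [RHS]mxE; apply: eq_bigr => c _.
  under eq_Rintegral do rewrite mulrAC.
  by rewrite RintegralZr//; congr (_ * _); rewrite /K mxE.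
have Kw a b y : (K y *m (1%:M + D y)) a b =
    dot (delta_mx a 0) (K y *m w (delta_mx b 0) y).
  by rewrite wE mulmxA dot_delta.
have ient a b : T1.-integrable setT (EFin \o fun y => (K y *m (1%:M + D y)) a b).
  under eq_fun do rewrite Kw.
  exact: form_int (sqint_cst _) (sqint_w _).
(* Both sides are expanded over the entries, so that the constants u_a and v_b can cross the
   integral. *)
transitivity (\int[T1]_y \sum_a \sum_b
    u a ord0 * ((K y *m (1%:M + D y)) a b * v b ord0)).
  rewrite (@Rintegral_sum _ _ _ _ _ _ (fun a y =>
    \sum_b u a ord0 * ((K y *m (1%:M + D y)) a b * v b ord0))); last first.
    move=> a; apply: (@integrable_Rsum _ _ _ _ _ _ (fun b y =>
      u a ord0 * ((K y *m (1%:M + D y)) a b * v b ord0))) => b.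
    by apply: integrable_Rzl; exact: integrable_Rzr.
  apply: eq_bigr => a _; rewrite mxE mulr_sumr.
  rewrite (@Rintegral_sum _ _ _ _ _ _ (fun b y =>
      u a ord0 * ((K y *m (1%:M + D y)) a b * v b ord0))); last first.
    by move=> b; apply: integrable_Rzl; exact: integrable_Rzr.
  apply: eq_bigr => b _.
  by rewrite RintegralZl ?RintegralZr ?entry//; exact: integrable_Rzr.
apply: eq_Rintegral => y _.
rewrite wE mulmxA.
by apply: eq_bigr => a _; rewrite [in RHS]mxE mulr_sumr.
Qed.

(** The added term, int (D theta u) . K w_v, is zero: it is the cell problem for v tested with theta
    . u. The result is symmetric in u and v. *)
Lemma tensor_rest_form u v :
  dot u (tensor_rest m.+1 x *m v) = \int[T1]_y dot (w u y) (K y *m w v y).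
Proof.
rewrite tensor_rest_step form_Dl; [|exact: sqint_D|exact: sqint_cst|exact: sqint_w].
by rewrite (weak_cell _ (is_H1_theta x u kN)) add0r.
Qed.

(** The field u + g differs from the corrected field w by g - D theta u. Both of its terms are
    gradients of H^1 functions, hence orthogonal to K w by the cell problem, and the Dirichlet
    principle applies. *)
Lemma tensor_minimal v g u : is_H1 v g ->
  dot u (tensor_rest m.+1 x *m u) <= \int[T1]_y dot (u + g y) (K y *m (u + g y)).
Proof.
move=> vg; rewrite tensor_rest_form.
have gi := square_integrable_grad vg.
have hi := square_integrableD gi (square_integrableN (sqint_D u)).
have -> : \int[T1]_y dot (u + g y) (K y *m (u + g y)) =
    \int[T1]_y dot (w u y + (g y - D y *m u)) (K y *m (w u y + (g y - D y *m u))).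
  apply: eq_Rintegral => y _.
  have -> // : w u y + (g y - D y *m u) = u + g y.
  by rewrite /w [D y *m u + u]addrC addrACA subrr addr0.
apply: (dirichlet_principle mK Ksym K_ge0 K_le (sqint_w u) hi).
rewrite form_Dl; [|exact: gi|exact: square_integrableN (sqint_D u)|exact: sqint_w].
rewrite (weak_cell _ vg) add0r.
under eq_Rintegral do rewrite dotNl -mulN1r.
rewrite RintegralZl//; last exact: form_int (sqint_D u) (sqint_w u).
by rewrite (weak_cell _ (is_H1_theta x u kN)) mulr0.
Qed.

Lemma represents_energyS : represents_energy m.+1 x.
Proof.
split.
- by move=> u; rewrite energy_integral_step tensor_rest_form.
- apply: matrix_dotP => u v.
  by rewrite dot_trmx trmxK dotC !tensor_rest_form energy_form_sym.
- move=> u.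
  (* Comparison with the zero function bounds the tensor by int u . K u, which is at most beta |u|^2
     as the torus has mass 1. *)
  have H0 : is_H1 (fun=> 0 : R) (fun=> 0 : point).
    have := is_H1_lin [::] (fun=> 0) (theta_H1 cellk x).
    by congr (is_H1 _ _); apply/funext => y; rewrite big_nil.
  apply: le_trans (tensor_minimal u H0) _.
  rewrite -[leRHS](Rintegral_mass_one_cst (torus_measure_setT R d)).
  apply: le_Rintegral => //.
  + by under eq_fun do rewrite addr0; exact: form_int (sqint_cst u) (sqint_cst u).
  + exact: (integrable_mass_one_cst (torus_measure_setT R d)).
  + by move=> y _; rewrite addr0; exact: K_le.
Qed.
End step.

Lemma chain0 s : chain 0 s = 1%:M.
Proof. by rewrite /partial_chain big_ord0. Qed.

Lemma represents_energy0 (x : N.+1.-tuple point) : represents_energy 0 x.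
Proof.
have tr : tensor_rest 0 x = weight x *: 1%:M.
  by rewrite -tensorE ?addn0// tensor_top /weight initial_id.
split.
- move=> u; rewrite tr -scalemxAl mul1mx dotZr.
  rewrite integral_dirac//; last first.
    by apply/measurable_EFinP; apply: measurable_energy_density; rewrite addn0.
  by rewrite diracT mul1e /energy_density chain0 mul1mx /= cats0 mulrC.
- by rewrite tr linearZ /= trmx1.
- move=> u; rewrite tr -scalemxAl mul1mx dotZr ler_wpM2r ?dot_ge0//.
  by have := weight_le x [::]; rewrite cats0.
Qed.

Lemma tensor_represents_energy m k (x : k.+1.-tuple point) : (k + m)%N = N ->
  represents_energy m x.
Proof.
elim: m k x => [|m IH] k x kmN.
  by move: x; rewrite -[k]addn0 kmN; exact: represents_energy0.
by apply: represents_energyS => // y; apply: IH; rewrite addSnnS.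
Qed.

Definition competitor_gradient (e : point)
    (g : forall l, l.+1.-tuple point -> point) (m : nat) (y : seq point) : point :=
  e + \sum_(l < m) g l (initial l.+1 y).

(** The counterpart of [tensor_rest] for the energy, again for induction on m. *)
Definition energy_rest m k (x : k.+1.-tuple point) (e : point)
    (g : forall l, l.+1.-tuple point -> point) : \bar R :=
  (\int[torus_power m]_y
    (dot (competitor_gradient e g m y) (competitor_gradient e g m y)
     * weight (x ++ y))%:E)%E.

Lemma energyE m k (x : k.+1.-tuple point) e g : (k + m)%N = N ->
  energy sigma V x e g = energy_rest m x e g.
Proof.
move=> kmN; have <- : (N - k)%N = m by rewrite -kmN addKn.
by [].
Qed.

Lemma initial_ext n (s t : seq point) :
  (forall j, (j < n)%N -> nth 0 s j = nth 0 t j) -> initial n s = initial n t.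
Proof. by move=> st; apply: eq_from_tnth => j; rewrite !tnth_mktuple st. Qed.

Lemma nth_initial n (s : seq point) j : (j < n)%N ->
  nth 0 (initial n s) j = nth 0 s j.
Proof. by move=> jn; rewrite -(tnth_nth 0 _ (Ordinal jn)) tnth_mktuple. Qed.

Lemma initial_tcons n m (y : point) (t : m.-tuple point) :
  initial n.+1 (tcons (y, t)) = tcons (y, initial n t).
Proof.
apply: eq_from_tnth => -[[|j] jn]; rewrite tnth_mktuple (tnth_nth 0) //=.
by rewrite nth_initial.
Qed.

Lemma initial1_tcons m (y : point) (t : m.-tuple point) :
  initial 1 (tcons (y, t)) = extend [tuple] y.
Proof. by apply: eq_from_tnth => j; rewrite !ord1 tnth_mktuple (tnth_nth 0). Qed.

(** * Lower bound on the energy of a competitor *)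

Section lower_bound.

(** Freezing the first integrated variable at y turns the later functions of a competitor into a
    competitor with one variable fewer. *)
Definition shift_function S (g : forall l, l.+1.-tuple point -> S) (y : point) l
  (s : l.+1.-tuple point) : S := g l.+1 (tcons (y, s)).

(** Once y is frozen, the first gradient is a constant vector and is absorbed into e. *)
Lemma competitor_gradient_tcons e g m y (t : m.-tuple point) :
  competitor_gradient e g m.+1 (tcons (y, t)) =
  competitor_gradient (e + g 0 (extend [tuple] y)) (shift_function g y) m t.
Proof.
rewrite /competitor_gradient big_ord_recl initial1_tcons addrA; congr (_ + _).
by apply: eq_bigr => l _; rewrite /shift_function -initial_tcons.
Qed.

Lemma periodic_from_tcons S n (F : n.+1.-tuple point -> S) y :
  periodic_from 0 F -> periodic_from 0 (fun s : n.-tuple point => F (tcons (y, s))).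
Proof.
move=> pF s z _.
pose z' (j : 'I_n.+1) := if unlift ord0 j is Some l then z l else 0.
rewrite -[RHS](pF _ z') //; congr F; apply: eq_from_tnth => j.
rewrite tnth_mktuple /z'; case: unliftP => [l ->|->].
  by rewrite !tnthS tnth_mktuple.
by rewrite map_mx0 addr0.
Qed.

Lemma competitor_shift m v g y : competitor m.+1 v g ->
  competitor m (shift_function v y) (shift_function g y).
Proof.
move=> [mv mg pv pg H1]; split => l lm.
- exact: (measurableT_comp (mv l.+1 lm) (@measurable_tcons1 _ _ l.+1 y)).
- exact: (measurableT_comp (mg l.+1 lm) (@measurable_tcons1 _ _ l.+1 y)).
- by apply: periodic_from_tcons; exact: pv.
- by apply: periodic_from_tcons; exact: pg.
- move=> p; have := H1 l.+1 lm (tcons (y, p)).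
  by congr (is_H1 _ _); apply/funext => z; [congr (v _ _)|congr (g _ _)];
    exact: val_inj.
Qed.

Lemma measurable_competitor_gradient m v g e : competitor m v g ->
  measurable_fun setT (fun y : m.-tuple point => competitor_gradient e g m y).
Proof.
move=> vg; apply: measurable_addmx => //.
apply: measurable_summx => l; apply: measurableT_comp.
  exact: (g_measurable vg).
exact: (@measurable_initial_cat _ _ _ _ _ _ _ (fun=> [tuple]) id).
Qed.

(** With the first variable y frozen, the induction hypothesis for the vector e + g_0(y) bounds the
    inner integral below by the quadratic form of K_{k+1}; integrating in y, [tensor_minimal] bounds
    the result below by that of K_k. *)
Lemma tensor_le_energy m k (x : k.+1.-tuple point) e v g : (k + m)%N = N ->
  competitor m v g ->
  ((dot e (tensor_rest m x *m e))%:E <= energy_rest m x e g)%E.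
Proof.
elim: m k x e v g => [|m IH] k x e v g kmN vg.
  rewrite -(energy_tensor (tensor_represents_energy x kmN)) /energy_rest.
  rewrite le_eqVlt; apply/orP; left; apply/eqP; apply: eq_integral => y _.
  by rewrite /energy_density chain0 mul1mx /competitor_gradient big_ord0 addr0.
have kmN' : (k.+1 + m)%N = N by rewrite addSnnS.
have rx y : represents_energy m (extend x y) by exact: tensor_represents_energy.
have vg0 : is_H1 (fun y => v 0 (extend [tuple] y)) (fun y => g 0 (extend [tuple] y)).
  exact: (v_H1 vg).
pose E p := dot (competitor_gradient e g m.+1 p) (competitor_gradient e g m.+1 p)
  * weight (x ++ p).
have E_tcons y (t : m.-tuple point) : E (tcons (y, t)) =
    dot (competitor_gradient (e + g 0 (extend [tuple] y)) (shift_function g y) m t)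
        (competitor_gradient (e + g 0 (extend [tuple] y)) (shift_function g y) m t)
    * weight (extend x y ++ t).
  by rewrite /E competitor_gradient_tcons cat_tcons.
have mE : measurable_fun setT (fun p : m.+1.-tuple point => (E p)%:E).
  apply/measurable_EFinP; apply: measurable_funM.
    by apply: measurable_dot; exact: measurable_competitor_gradient vg.
  exact: measurable_weight.
have E_ge0 (p : m.+1.-tuple point) : (0 <= (E p)%:E)%E.
  by rewrite lee_fin mulr_ge0 ?dot_ge0 ?weight_ge0.
rewrite /energy_rest ge0_integral_tprodS//.
have mK : measurable_fun setT (fun y => tensor_rest m (extend x y)).
  exact: measurable_tensor_rest.
have [mg0 _] := square_integrable_grad vg0.
apply: (@le_trans _ _ (\int[T1]_y (dot (e + g 0 (extend [tuple] y))
    (tensor_rest m (extend x y) *m (e + g 0 (extend [tuple] y))))%:E)%E).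
  apply: le_trans (_ : _ <= (\int[T1]_y dot (e + g 0 (extend [tuple] y))
    (tensor_rest m (extend x y) *m (e + g 0 (extend [tuple] y))))%:E)%E _.
    by rewrite lee_fin; exact: tensor_minimal vg0.
  (* [tensor_minimal] speaks of a real-valued integral; it agrees with the extended one because the
     energy of e + g_0 is finite. *)
  rewrite /Rintegral fineK//.
  apply: integrable_fin_num => //.
  have wi := square_integrableD (sqint_cst e) (square_integrable_grad vg0).
  apply: (integrable_energy_form mK (fun y => tensor_sym (rx y))
    (fun y => tensor_ge0 (rx y)) _ wi wi (beta := B (thead x))) => y u.
  by rewrite -(thead_extend x y); exact: tensor_le (rx y) u.
apply: ge0_le_integral => //.
- by move=> y _; rewrite lee_fin; exact: tensor_ge0 (rx y) _.
- apply/measurable_EFinP; apply: measurable_dot; first exact: measurable_addmx.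
  by apply: measurable_mulmx => //; exact: measurable_addmx.
- apply: (@ge0_measurable_integral_tprod _ _ _ _ _ _ _
    (fun p : point * m.-tuple point => (E (tcons (p.1, p.2)))%:E)) => // .
  apply: (measurableT_comp mE).
  by under eq_fun do rewrite -surjective_pairing; exact: measurable_tcons.
- move=> y _.
  apply: le_trans (IH _ (extend x y) _ _ _ kmN' (competitor_shift y vg)) _.
  rewrite le_eqVlt; apply/orP; left; apply/eqP; apply: eq_integral => t _.
  by rewrite -E_tcons.
Qed.
End lower_bound.

(** * The minimizing competitor *)

Section minimizer.
Variables (i : nat) (x : i.+1.-tuple point) (e : point).

(** Here the leftmost factor is peeled off, whereas [chain_extend] peels off the rightmost. *)
Lemma partial_chainS n m s : partial_chain n.+1 m.+1 s =
  (1%:M + Dtheta n.+1 (initial n.+2 s)) *m partial_chain n m s.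
Proof. by rewrite /partial_chain big_ord_recl. Qed.

Lemma partial_chain_ext n m s t :
  (forall j, (j <= n)%N -> nth 0 s j = nth 0 t j) ->
  partial_chain n m s = partial_chain n m t.
Proof.
move=> st; apply: eq_bigr => l _; congr (_ + Dtheta _ _).
by apply: initial_ext => j; rewrite ltnS => jn; exact/st/(leq_trans jn)/leq_subr.
Qed.

(** The vector (I + D theta_{i+l}) ... (I + D theta_{i+1}) e. It reads the variables up to x_{i+l}
    only, and so acts as a constant for v_{i+l+1}. *)
Definition minimizer_direction l (y : seq point) : point :=
  partial_chain (i + l) l (x ++ y) *m e.

Definition minimizer l (y : l.+1.-tuple point) : R :=
  dot (theta (i + l).+1 (initial (i + l).+2 (x ++ y))) (minimizer_direction l y).

Definition minimizer_grad l (y : l.+1.-tuple point) : point :=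
  Dtheta (i + l).+1 (initial (i + l).+2 (x ++ y)) *m minimizer_direction l y.

Lemma nth_cat_initial k (y : seq point) j : (j < i.+1 + k)%N ->
  nth 0 (x ++ initial k y) j = nth 0 (x ++ y) j.
Proof.
move=> jk; rewrite !nth_cat size_tuple; case: ltnP => // ij.
by rewrite nth_initial// ltn_subLR.
Qed.

(** The sum telescopes: adding D theta_{i+m+1} p to the direction p gives (I + D theta_{i+m+1}) p,
    the next direction. *)
Lemma minimizer_gradientE m (y : seq point) :
  competitor_gradient e minimizer_grad m y = minimizer_direction m y.
Proof.
rewrite /competitor_gradient; elim: m => [|m IH].
  by rewrite big_ord0 addr0 /minimizer_direction /partial_chain big_ord0 mul1mx.
rewrite big_ord_recr -[minimizer_grad _]/(minimizer_grad (initial m.+1 y)).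
rewrite addrA IH [in RHS]/minimizer_direction addnS partial_chainS.
rewrite -mulmxA mulmxDl mul1mx /minimizer_grad /minimizer_direction.
rewrite (@initial_ext _ _ (x ++ y)); last first.
  by move=> j jm; rewrite nth_cat_initial// addSn addnS.
rewrite (@partial_chain_ext _ _ _ (x ++ y)) // => j jm.
by rewrite nth_cat_initial// addSn ltnS addnS leqW.
Qed.

Lemma periodic_initial S n m (F : n.+1.-tuple point -> S) : periodic_from 1 F ->
  (n <= i + m)%N ->
  periodic_from 0 (fun y : m.-tuple point => F (initial n.+1 (x ++ y))).
Proof.
move=> pF nm y z _.
(* The translation is zero on the i+1 fixed points, in particular on x_0, where F need not be
   periodic. *)
pose z' (j : 'I_n.+1) := nth 0 (nseq i.+1 0 ++ [tuple z l | l < m]) j.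
rewrite -[RHS](pF _ z').
  congr F; apply: eq_from_tnth => j; rewrite !tnth_mktuple /z' !nth_cat.
  rewrite size_tuple size_nseq; case: ltnP => ji.
    by rewrite nth_nseq ji map_mx0 addr0.
  have jm : (j - i.+1 < m)%N.
    by rewrite ltn_subLR// addSn ltnS (leq_trans _ nm)// -ltnS.
  by rewrite -!(tnth_nth 0 _ (Ordinal jm)) !tnth_mktuple.
by move=> l; rewrite ltnS leqn0 => /eqP l0; rewrite /z' l0.
Qed.

Lemma periodic_partial_chain n m p : (m <= n <= N)%N -> (n <= i + p)%N ->
  periodic_from 0 (fun y : p.-tuple point => partial_chain n m (x ++ y)).
Proof.
move=> /andP[mn nN] np y z h; apply: eq_bigr => l _; congr (_ + _).
apply: (@periodic_initial _ (n - l) p (Dtheta (n - l))) => //.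
  apply: Dtheta_periodic; apply: cell.
  by rewrite subn_gt0 (leq_trans (ltn_ord l))// (leq_trans (leq_subr _ _)).
exact: leq_trans (leq_subr _ _) np.
Qed.

Lemma initial_minimizer l (p : l.-tuple point) y :
  initial (i + l).+2 (x ++ extend p y) = extend [tuple of x ++ p] y.
Proof. by apply: initial_eq; rewrite /= rcons_cat. Qed.

Lemma minimizer_direction_extend l (p : l.-tuple point) y :
  minimizer_direction l (extend p y) = minimizer_direction l p.
Proof.
rewrite /minimizer_direction; congr (_ *m _); apply: partial_chain_ext => j jl.
by rewrite /= -rcons_cat nth_rcons size_cat !size_tuple addSn ltnS jl.
Qed.

Lemma competitor_minimizer : (i <= N)%N ->
  competitor (N - i) minimizer minimizer_grad.
Proof.
move=> iN.
have ilN l : (l < N - i)%N -> (1 <= (i + l).+1 <= N)%N.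
  by rewrite ltn_subRL.
have mdir l : (l < N - i)%N ->
    measurable_fun setT (fun y : l.+1.-tuple point => minimizer_direction l y).
  move=> /ilN/andP[_ lN]; apply: measurable_mulmx => //.
  apply: measurable_chain => //.
  by rewrite leq_addl ltnW.
have minit l : measurable_fun setT
    (fun y : l.+1.-tuple point => initial (i + l).+2 (x ++ y)).
  exact: measurable_initial_cat.
have pdir l : (l < N - i)%N ->
    periodic_from 0 (fun y : l.+1.-tuple point => minimizer_direction l y).
  move=> /ilN/andP[_ lN] y z h; rewrite /minimizer_direction; congr (_ *m _).
  apply: periodic_partial_chain => //; first by rewrite leq_addl ltnW.
  by rewrite addnS.
split => l lN.
- apply: measurable_dot; last exact: mdir.
  by apply: measurableT_comp (minit l); apply: theta_measurable; apply/cell/ilN.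
- apply: measurable_mulmx; last exact: mdir.
  by apply: measurableT_comp (minit l); apply: Dtheta_measurable; apply/cell/ilN.
- move=> y z h; rewrite /minimizer pdir//; congr (dot _ _).
  apply: (@periodic_initial _ _ _ (theta (i + l).+1)) => //; last by rewrite addnS.
  by apply: theta_periodic; apply/cell/ilN.
- move=> y z h; rewrite /minimizer_grad pdir//; congr (_ *m _).
  apply: (@periodic_initial _ _ _ (Dtheta (i + l).+1)) => //; last by rewrite addnS.
  by apply: Dtheta_periodic; apply/cell/ilN.
- move=> p.
  (* As a function of its last variable, the minimizer is theta . u with u the direction at [p],
     which does not depend on that variable. *)
  have := is_H1_theta [tuple of x ++ p] (minimizer_direction l p) (ilN _ lN).
  congr (is_H1 _ _); apply/funext => y.
    by rewrite /minimizer initial_minimizer minimizer_direction_extend.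
  by rewrite /minimizer_grad initial_minimizer minimizer_direction_extend.
Qed.

Lemma energy_minimizer m : (i + m)%N = N ->
  energy_rest m x e minimizer_grad = (dot e (tensor_rest m x *m e))%:E.
Proof.
move=> imN; rewrite -(energy_tensor (tensor_represents_energy x imN)).
apply: eq_integral => y _.
by rewrite minimizer_gradientE /minimizer_direction imN.
Qed.
End minimizer.

(** The tensor is a lower bound for all energies, and the minimizer attains it. *)
Lemma tensor_energy_inf i (x : i.+1.-tuple point) e : (i <= N)%N ->
  (dot e (tensor sigma V Dtheta x *m e))%:E =
  ereal_inf [set J | exists v g,
    competitor (N - i) v g /\ J = energy sigma V x e g].
Proof.
move=> iN; have imN := subnKC iN; rewrite (tensorE _ imN).
apply/eqP; rewrite eq_le; apply/andP; split.
  apply: le_ereal_inf_tmp => _ [v [g [vg ->]]]; rewrite (energyE _ _ _ imN).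
  exact: tensor_le_energy vg.
apply: ereal_inf_lbound; exists (minimizer x e), (minimizer_grad x e).
by split; [exact: competitor_minimizer|rewrite (energyE _ _ _ imN) energy_minimizer].
Qed.
End homogenized_tensor.

(** * Measurability of the potential and boundedness of the weight *)

Section potential_theory.
Context (R : realType) (d N : nat) (sigma : R).
Local Notation point := 'cV[R]_d.
Variables (V V1 : N.+1.-tuple point -> R) (V0 : point -> R).
Hypothesis pot : potential V V0 V1.

(** Smoothness of order 0 is continuity of V as a function of the matrix whose columns are the
    points; the map from tuples to that matrix is measurable. *)
Lemma measurable_potential : measurable_fun setT V.
Proof.
have cV := measurable_continuous_mx (V_smooth pot 0%N).
pose M (z : N.+1.-tuple point) : 'M[R]_(d, N.+1) := \matrix_(a, l) tnth z l a ord0.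
have mM : measurable_fun setT M.
  apply/measurable_mxP => a l; under eq_fun do rewrite mxE.
  by have /measurable_mxP := @measurable_tnth _ point _ l; exact.
have := measurableT_comp cV mM; congr measurable_fun.
apply/funext => z /=; congr V; apply: eq_from_tnth => l.
by rewrite tnth_mktuple; apply/colP => a; rewrite !mxE.
Qed.

Lemma weight_bounded : 0 < sigma -> exists B : point -> R,
  forall k (x : k.+1.-tuple point) (s : seq point),
    weight sigma V (x ++ s) <= B (thead x).
Proof.
move=> s0; have [C V1C] := V1_bounded pot.
(* From V_1 >= -C one gets -V <= C - V_0(x_0), and dividing by sigma > 0 keeps the order. *)
exists (fun p => expR ((C - V0 p) / sigma)) => k x s.
rewrite ler_expR ler_pM2r ?invr_gt0// (V_split pot).
have -> : thead (initial N.+1 (x ++ s)) = thead x.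
  by rewrite /thead tnth_mktuple nth_cat size_tuple (tnth_nth 0).
by have := V1C (initial N.+1 (x ++ s)); rewrite ler_norml; lra.
Qed.
End potential_theory.

Theorem lemma3p2 (R : realType) (d N : nat) (sigma : R)
    (V : N.+1.-tuple 'cV[R]_d -> R) (V0 : 'cV[R]_d -> R)
    (V1 : N.+1.-tuple 'cV[R]_d -> R)
    (theta : forall k : nat, k.+1.-tuple 'cV[R]_d -> 'cV[R]_d)
    (Dtheta : forall k : nat, k.+1.-tuple 'cV[R]_d -> 'M[R]_d) :
  (1 <= d)%N -> (1 <= N)%N -> 0 < sigma ->
  potential V V0 V1 ->
  (forall k : nat, (1 <= k <= N)%N -> cell_solution sigma V theta Dtheta k) ->
  forall i : nat, (1 <= i <= N)%N ->
  forall (x : i.+1.-tuple 'cV[R]_d) (e : 'cV[R]_d),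
    (dot e (tensor sigma V Dtheta x *m e))%:E =
    ereal_inf [set J | exists v : forall l : nat, l.+1.-tuple 'cV[R]_d -> R,
                       exists g : forall l : nat, l.+1.-tuple 'cV[R]_d -> 'cV[R]_d,
                       competitor (N - i) v g /\ J = energy sigma V x e g].
Proof.
move=> _ _ sigma0 pot cell i /andP[_ iN] x e.
have [B weight_le] := weight_bounded pot sigma0.
exact: (tensor_energy_inf (measurable_potential pot) cell weight_le x e iN).
Qed.
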